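(* Let $k>0$, $\gamma>0$, $\lambda>0$ and $x>0$ be fixed. Then the function $$\nu\mapsto \mathcal{I}_{k,\nu}^{\gamma,\lambda}(x):=\Gamma_k(\nu+1)\,\mathtt{I}_{k,\nu}^{\gamma,\lambda}(x)$$ is log-convex on $(0,\infty)$, i.e. $\nu\mapsto\log \mathcal{I}_{k,\nu}^{\gamma,\lambda}(x)$ is convex on $(0,\infty)$.
   Context: For $k>0$, the $k$-Pochhammer symbol is $(x)_{n,k}:=x(x+k)(x+2k)\cdots(x+(n-1)k)$ (with $(x)_{0,k}=1$), and the $k$-gamma function is $\Gamma_k(x)=\int_0^\infty t^{x-1}e^{-t^k/k}\,dt$ for $x>0$; equivalently $\Gamma_k(x)=k^{\frac{x}{k}-1}\Gamma\left(\frac{x}{k}\right)$. The modified $k$-Bessel function of the first kind is $$\mathtt{I}_{k,\nu}^{\gamma,\lambda}(x):=\sum_{n=0}^{\infty}\frac{(\gamma)_{n,k}}{\Gamma_k(\lambda n+\nu+1)}\,\frac{(x/2)^n}{(n!)^2}.$$ *)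

(* Defs.v *)
From mathcomp Require Import all_boot all_order all_algebra.
From mathcomp Require Import all_classical all_reals all_analysis.

Set Implicit Arguments.
Unset Strict Implicit.
Unset Printing Implicit Defensive.

Import Order.TTheory GRing.Theory Num.Theory.
Import numFieldNormedType.Exports.

Local Open Scope classical_set_scope.
Local Open Scope ring_scope.

Definition pochhammer_k (R : realType) (k x : R) (n : nat) : R :=
  \prod_(i < n) (x + i%:R * k).

(* A finite value is only guaranteed for 0 < k and 0 < x. *)
Definition Gamma_k (R : realType) (k x : R) : R :=
  (\int[lebesgue_measure]_(t in `]0%R, +oo[)
     (t `^ (x - 1) * expR (- (t `^ k / k))))%R.

Definition bessel_k (R : realType) (k gamma lambda nu x : R) : R :=
  limn (series (fun n : nat =>
    pochhammer_k k gamma n / Gamma_k k (lambda * n%:R + nu + 1)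
    * ((x / 2) ^+ n / (n`!)%:R ^+ 2))).

Definition normalized_bessel_k (R : realType) (k gamma lambda nu x : R) : R :=
  Gamma_k k (nu + 1) * bessel_k k gamma lambda nu x.

(* Positivity is required explicitly because [ln] is a total function, equal
   to 0 on nonpositive arguments; it also rules out the default value 0 that
   [limn] takes on a divergent series. *)
Definition log_convex_on (R : realType) (D : set R) (f : R -> R) : Prop :=
  (forall y, D y -> 0 < f y) /\
  convex_function (D : set (convex_lmodType R^o)) (fun y => ln (f y)).

(* Main.v *)
Require Import Defs.
From mathcomp Require Import all_boot all_order all_algebra.
From mathcomp Require Import all_classical all_reals all_analysis.
From mathcomp Require Import measurable_realfun ring lra.

Set Implicit Arguments.
Unset Strict Implicit.
Unset Printing Implicit Defensive.

Import Order.TTheory GRing.Theory Num.Theory.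
Import numFieldNormedType.Exports.

Local Open Scope classical_set_scope.
Local Open Scope ring_scope.

(** Each term of the series for [Gamma_k (nu + 1) * bessel_k nu] is a
    nonnegative constant times [Gamma_k s / Gamma_k (s + a)] with [s = nu + 1]
    and [a = lambda * n]. Substituting [y = x * v] in the second factor of
    [Gamma_k s * Gamma_k a], exchanging the integrals and rescaling [x] gives
      [Gamma_k s / Gamma_k (s + a) =
        (Gamma_k a)^-1 * \int_0^oo v `^ (a - 1) * (1 + v `^ k) `^ (- (s + a) / k)].
    The integrand is log-affine in [s], and log-convexity survives integration
    and summation. *)

(** * Scaling of integrals, Tonelli on rectangles, integrals of powers *)

(** Lebesgue measure is [c] times its image under multiplication by [c]: the two agree on half-open
    intervals, and uniqueness extends this to all measurable sets. *)
Lemma integral_scale_pos (R : realType) (c : R) (f : R -> R) :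
  0 < c -> measurable_fun setT f -> (forall x, 0 < x -> 0 <= f x) ->
  (\int[lebesgue_measure]_(x in `]0%R, +oo[) (f x)%:E =
   \int[lebesgue_measure]_(x in `]0%R, +oo[) (c * f (c * x))%:E)%E.
Proof.
move=> c0 mf f0.
have f0' x : `]0, +oo[%classic x -> (0 <= (f x)%:E)%E.
  by rewrite /= in_itv/= andbT lee_fin => /f0.
pose phi : measurableTypeR R -> measurableTypeR R := *%R c.
have mc : measurable_fun setT phi by exact: measurable_funM.
have mfE : measurable_fun setT (EFin \o f) by exact/measurable_EFinP.
under [RHS]eq_integral do rewrite EFinM.
rewrite ge0_integralZl_EFin//=; last 3 first.
- by move=> x; rewrite /= !in_itv/= !andbT => x0; rewrite lee_fin f0// mulr_gt0.
- by apply: measurable_funTS; exact: (measurableT_comp mfE mc).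
- exact: ltW.
have -> : `]0, +oo[%classic = phi @^-1` `]0, +oo[%classic.
  by apply/seteqP; split=> x /=; rewrite !in_itv/= !andbT pmulr_rgt0.
rewrite -(ge0_integral_pushforward mc _ _ (f := EFin \o f))//=; last 2 first.
- exact: measurable_funTS.
- by move=> x; rewrite inE; exact: f0'.
have -> : phi @^-1` `]0, +oo[%classic = `]0, +oo[%classic.
  by apply/seteqP; split=> x /=; rewrite !in_itv/= !andbT pmulr_rgt0.
rewrite -(ge0_integral_mscale _ _ (NngNum (ltW c0)))//=; last first.
  exact: measurable_funTS.
apply: eq_measure_integral => /= A mA _; symmetry.
apply/esym/lebesgue_measure_unique => //= _ [[a b]] _ <-.
rewrite /mscale/= /pushforward.
have -> : phi @^-1` `]a, b]%classic = `]c^-1 * a, c^-1 * b]%classic.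
  by apply/seteqP; split=> x /=; rewrite !in_itv/= ltr_pdivrMl// ler_pdivlMl.
rewrite !lebesgue_measure_itv/= !lte_fin ltr_pM2l ?invr_gt0//.
case: ifPn => _; last by rewrite mule0.
by rewrite -EFinB -EFinM -mulrBr mulrA mulfV ?gt_eqF// mul1r.
Qed.

(** Extending [f] by zero off the rectangle reduces to Tonelli on the whole product. Nonnegativity
    is assumed on the rectangle only, because the Jacobian factor of the later integrand is negative
    off the half-line. *)
Lemma fubini_tonelli_setX d1 d2 (T1 : measurableType d1) (T2 : measurableType d2)
    (R : realType) (m1 : {sigma_finite_measure set T1 -> \bar R})
    (m2 : {sigma_finite_measure set T2 -> \bar R})
    (A : set T1) (B : set T2) (f : T1 * T2 -> \bar R) :
  measurable A -> measurable B -> measurable_fun setT f ->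
  (forall z, (A `*` B) z -> (0 <= f z)%E) ->
  (\int[m1]_(x in A) \int[m2]_(y in B) f (x, y) =
   \int[m2]_(y in B) \int[m1]_(x in A) f (x, y))%E.
Proof.
move=> mA mB mf f0.
pose g := f \_ (A `*` B).
have mAB : measurable (A `*` B) by exact: measurableX.
have mg : measurable_fun setT g.
  by apply: (measurable_restrictT f mAB).1; exact: measurable_funTS.
have g0 z : (0 <= g z)%E by exact: erestrict_ge0.
transitivity (\int[m1]_x \int[m2]_y g (x, y))%E.
  rewrite integral_mkcond; apply: eq_integral => x _.
  rewrite patchE; case: ifPn => xA.
    rewrite integral_mkcond; apply: eq_integral => y _.
    by rewrite /g !patchE in_setX xA.
  by rewrite integral0_eq// => y _; rewrite /g patchE in_setX (negbTE xA).
rewrite (fubini_tonelli g)//.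
rewrite [RHS]integral_mkcond; apply: eq_integral => y _.
rewrite patchE; case: ifPn => yB.
  rewrite [RHS]integral_mkcond; apply: eq_integral => x _.
  by rewrite /g !patchE in_setX yB andbT.
by rewrite integral0_eq// => x _; rewrite /g patchE in_setX (negbTE yB) andbF.
Qed.

(** Any nonzero [p] is allowed so as to cover both uses: [p = s] near 0 and [p = - 1] for the
    tail. *)
Lemma integral_powR (R : realType) (p a b : R) : p != 0 -> 0 < a -> a < b ->
  (\int[lebesgue_measure]_(x in `[a, b]) (x `^ (p - 1))%:E =
   (p^-1 * (b `^ p - a `^ p))%:E)%E.
Proof.
move=> p0 a0 ab.
have dF (x : R) : 0 < x -> is_derive x 1 (fun x => p^-1 * x `^ p) (x `^ (p - 1)).
  move=> x0.
  have := is_deriveZ p^-1 (is_derive1_powR p x0).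
  by rewrite /GRing.scale/= mulrA mulVf// mul1r.
have cpow q (x : R) : 0 < x -> {for x, continuous (fun x : R => x `^ q)}.
  move=> x0; apply: differentiable_continuous; apply/derivable1_diffP.
  by apply: derivable_powR; rewrite in_itv/= andbT.
have cF (x : R) : 0 < x -> {for x, continuous (fun x : R => p^-1 * x `^ p)}.
  by move=> x0; apply: continuousM; [exact: cvg_cst|exact: cpow].
rewrite (@continuous_FTC2 R _ (fun x => p^-1 * x `^ p))//.
- by rewrite -EFinB mulrBr.
- apply: continuous_in_subspaceT => x; rewrite inE/= in_itv/= => /andP[ax _].
  by apply: cpow; exact: lt_le_trans ax.
- split.
  + move=> x; rewrite in_itv/= => /andP[ax _].
    by apply: ex_derive; apply: dF; exact: lt_trans ax.
  + by apply: cvg_at_right_filter; exact: cF.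
  + by apply: cvg_at_left_filter; apply: cF; exact: lt_trans ab.
- move=> x; rewrite in_itv/= => /andP[ax _].
  rewrite derive1E; apply: derive_val; apply: dF; exact: lt_trans ax.
Qed.

(** * The k-gamma integral: finiteness and a lower bound *)

Definition gamma_k_density (R : realType) (k s t : R) : R :=
  t `^ (s - 1) * expR (- (t `^ k / k)).

(** The extended-real integral of which [Gamma_k] is the [fine] part, suited to Tonelli and monotone
    limits. *)
Definition egamma_k (R : realType) (k s : R) : \bar R :=
  (\int[lebesgue_measure]_(t in `]0%R, +oo[) (gamma_k_density k s t)%:E)%E.

Lemma measurable_gamma_k_density (R : realType) (k s : R) (D : set R) :
  measurable_fun D (gamma_k_density k s).
Proof.
apply: measurable_funTS; apply: measurable_funM => //.
apply: measurableT_comp => //; apply: measurableT_comp => //.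
exact: measurable_funM.
Qed.

Lemma gamma_k_density_ge0 (R : realType) (k s t : R) : 0 <= gamma_k_density k s t.
Proof. by rewrite mulr_ge0 ?powR_ge0 ?expR_ge0. Qed.

Lemma gamma_k_density_le_head (R : realType) (k s t : R) : 0 < k ->
  gamma_k_density k s t <= t `^ (s - 1).
Proof.
move=> k0; rewrite ler_piMr ?powR_ge0// -expR0 ler_expR oppr_le0.
by rewrite divr_ge0 ?powR_ge0 ?ltW.
Qed.

(* [expR u >= (u / p) `^ p] with [u = t `^ k / k] and [p = (s + 1) / k]. *)
Lemma gamma_k_density_le_tail (R : realType) (k s t : R) :
  0 < k -> 0 < s -> 0 < t ->
  gamma_k_density k s t <= (s + 1) `^ ((s + 1) / k) * t `^ (- 1 - 1).
Proof.
move=> k0 s0 t0; set p := (s + 1) / k.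
have s10 : 0 < s + 1 by rewrite addr_gt0.
have p0 : 0 < p by rewrite divr_gt0.
have -> : t `^ (- 1 - 1) = t `^ (s - 1) * t `^ (- (s + 1)).
  by rewrite -powRD ?(gt_eqF t0) ?implybT//; congr (_ `^ _); ring.
rewrite mulrCA ler_wpM2l ?powR_ge0// expRN powRN -lef_pV2 ?posrE; last 2 first.
- by rewrite mulr_gt0 ?invr_gt0 ?powR_gt0.
- by rewrite invr_gt0 expR_gt0.
rewrite invfM !invrK mulrC -ler_pdivlMr ?invr_gt0 ?powR_gt0// invrK.
have -> : t `^ k / k = t `^ k / (s + 1) * p by rewrite /p; field; rewrite !gt_eqF.
rewrite expRM mulrC.
have -> : t `^ (s + 1) = (t `^ k) `^ p.
  by rewrite -powRrM; congr (_ `^ _); rewrite /p; field; rewrite gt_eqF.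
rewrite -powRM ?expR_ge0 ?(ltW s10)//.
have h0 : 0 <= (s + 1) * expR (t `^ k / (s + 1)).
  by rewrite mulr_ge0 ?expR_ge0 ?(ltW s10).
apply: ge0_ler_powR; rewrite ?nnegrE ?powR_ge0 ?(ltW p0)//.
rewrite -ler_pdivrMl// mulrC.
by apply: le_trans (expR_ge1Dx _); rewrite lerDr.
Qed.

(** The compact intervals [F n] exhaust the half-line, and the integrals over them are bounded
    uniformly: by [s^-1] on the part up to 1, by [C] on the part beyond. *)
Lemma egamma_k_lty (R : realType) (k s : R) : 0 < k -> 0 < s ->
  (egamma_k k s < +oo)%E.
Proof.
move=> k0 s0.
(* Starting at [n.+2] gives [n.+2%:R^-1 < 1 < n.+2%:R], so that every [F n] splits at 1 into two
   nondegenerate pieces. *)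
pose F n : set R := `[n.+2%:R^-1, n.+2%:R]%classic.
have mg D : measurable_fun D (EFin \o gamma_k_density k s).
  by apply/measurable_EFinP; exact: measurable_gamma_k_density.
have mpow D p : measurable_fun D (fun t : R => (t `^ p)%:E).
  by apply/measurable_EFinP; exact: measurable_funTS.
have FE : \bigcup_n F n = `]0, +oo[%classic.
  apply/seteqP; split => [x [n _]|x] /=; rewrite /F /= !in_itv/= ?andbT.
    by move=> /andP[nx _]; apply: lt_le_trans nx; rewrite invr_gt0.
  move=> x0; have xV0 : 0 < x^-1 by rewrite invr_gt0.
  have h := archi_boundP (addr_ge0 (ltW x0) (ltW xV0)).
  (* A bound on [x + x^-1] exceeds both [x] and [x^-1]. *)
  exists (Num.Def.archi_bound (x + x^-1)) => //=; rewrite in_itv/=.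
  set n := Num.Def.archi_bound _ in h *.
  have nn : n%:R <= n.+2%:R :> R by rewrite ler_nat -addn2 leq_addr.
  rewrite -[X in _ <= X <= _]invrK lef_pV2 ?posrE//.
  by apply/andP; split; apply: ltW; apply: lt_le_trans nn; lra.
have ndF : {homo F : n m / (n <= m)%N >-> (n <= m)%O}.
  move=> n m nm; rewrite subsetEset => x; rewrite /F /= !in_itv/= => /andP[nx xn].
  apply/andP; split.
    by apply: le_trans nx; rewrite lef_pV2 ?posrE// ler_nat.
  by apply: le_trans xn _; rewrite ler_nat.
have cF := @ge0_nondecreasing_set_cvg_integral _ (measurableTypeR R) R F
  (EFin \o gamma_k_density k s) lebesgue_measure ndF (fun=> measurable_itv _)
  (fun=> mg _) (fun _ x _ => gamma_k_density_ge0 k s x).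
set C := (s + 1) `^ ((s + 1) / k).
have C0 : 0 <= C by exact: powR_ge0.
suff bF n : (\int[lebesgue_measure]_(t in F n) (gamma_k_density k s t)%:E <=
    (s^-1 + C)%:E)%E.
  rewrite /egamma_k -FE -(cvg_lim _ cF)//.
  apply: (@le_lt_trans _ _ (s^-1 + C)%:E); last exact: ltry.
  by apply: lime_le; [apply/cvg_ex; eexists; exact: cF|exact: nearW].
have n1 : n.+2%:R^-1 < 1 :> R by rewrite invf_lt1// ltr1n.
have n1' : 1 < n.+2%:R :> R by rewrite ltr1n.
have -> : F n = `[n.+2%:R^-1, 1] `|` `]1, n.+2%:R].
  by rewrite /F (@itv_bndbnd_setU _ _ _ (BRight 1))// bnd_simp ltW.
have g0 x : (0 <= (gamma_k_density k s x)%:E)%E.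
  by rewrite lee_fin gamma_k_density_ge0.
rewrite ge0_integral_setU//=; last 2 first.
- exact: mg.
- by apply/disj_setPS => x [] /=; rewrite !in_itv/= => /andP[_ h] /andP[]; rewrite ltNge h.
rewrite EFinD; apply: leeD.
- apply: (@le_trans _ _ (\int[lebesgue_measure]_(t in `[n.+2%:R^-1%R, 1%R])
      (t `^ (s - 1))%:E)%E).
    apply: ge0_le_integral => //=; [exact: mg|exact: mpow|].
    by move=> x _; rewrite lee_fin gamma_k_density_le_head.
  rewrite (@integral_powR _ s) ?(gt_eqF s0)// ?invr_gt0// lee_fin ler_piMr ?invr_ge0 ?(ltW s0)//.
  by rewrite powR1 gerBl powR_ge0.
- apply: (@le_trans _ _ (\int[lebesgue_measure]_(t in `]1%R, n.+2%:R])
      (C%:E * (t `^ (- 1 - 1)%R)%:E))%E).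
    apply: ge0_le_integral => //=; [exact: mg|exact: (measurable_funeM _ (mpow _ _))|].
    move=> x; rewrite /= in_itv/= => /andP[x1 _].
    by rewrite lee_fin gamma_k_density_le_tail// (lt_trans _ x1).
  (* Adding the endpoint 1 gives the closed interval that [integral_powR] expects. *)
  apply: (@le_trans _ _ (\int[lebesgue_measure]_(t in `[1%R, n.+2%:R])
      (C%:E * (t `^ (- 1 - 1)%R)%:E))%E).
    apply: ge0_subset_integral => //=; first exact: (measurable_funeM _ (mpow _ _)).
      by move=> x _; rewrite lee_fin mulr_ge0 ?powR_ge0.
    by apply: subset_itv; rewrite bnd_simp.
  rewrite ge0_integralZl_EFin//=; last 2 first.
  - by move=> x _; rewrite lee_fin powR_ge0.
  - exact: mpow.
  rewrite (@integral_powR _ (- 1)) ?oppr_eq0// -EFinM lee_fin ler_piMr//.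
  rewrite invrN1 powR1 mulN1r opprB lerBlDr lerDl powR_ge0//.
Qed.

Lemma egamma_k_fin_num (R : realType) (k s : R) : 0 < k -> 0 < s ->
  egamma_k k s \is a fin_num.
Proof.
move=> k0 s0; rewrite ge0_fin_numE ?egamma_k_lty//.
by apply: integral_ge0 => x _; rewrite lee_fin gamma_k_density_ge0.
Qed.

Lemma Gamma_kE (R : realType) (k s : R) : 0 < k -> 0 < s ->
  (Gamma_k k s)%:E = egamma_k k s.
Proof. by move=> k0 s0; rewrite fineK// egamma_k_fin_num. Qed.

(* On [`[1, 2]] the density is at least [t^-1 * expR (- (2 `^ k / k))]. *)
Lemma Gamma_k_ge (R : realType) (k s : R) : 0 < k -> 0 < s ->
  2^-1 * expR (- (2 `^ k / k)) <= Gamma_k k s.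
Proof.
move=> k0 s0; rewrite -lee_fin Gamma_kE// /egamma_k.
set c := 2^-1 * _.
have mg D : measurable_fun D (EFin \o gamma_k_density k s).
  by apply/measurable_EFinP; exact: measurable_gamma_k_density.
have g0 x : (0 <= (gamma_k_density k s x)%:E)%E.
  by rewrite lee_fin gamma_k_density_ge0.
apply: (@le_trans _ _ (\int[lebesgue_measure]_(t in `[1%R, 2%R])
    (gamma_k_density k s t)%:E)%E); last first.
  apply: ge0_subset_integral => //=; first exact: mg.
  by move=> x /=; rewrite !in_itv/= andbT => /andP[x1 _]; exact: lt_le_trans x1.
have -> : c%:E = (\int[lebesgue_measure]_(t in `[1%R, 2%R]) c%:E)%E.
  rewrite integral_cst//= lebesgue_measure_itv/= lte_fin ltr1n/=.
  by rewrite -EFinB -EFinM; congr (_%:E); ring.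
apply: ge0_le_integral => //=.
- by move=> x _; rewrite lee_fin mulr_ge0 ?expR_ge0.
- exact: mg.
- move=> x; rewrite /= in_itv/= => /andP[x1 x2]; rewrite lee_fin.
  have x0 : (0 : R) < x by exact: lt_le_trans x1.
  rewrite /c ler_pM ?expR_ge0//.
    (* The first bound uses [x <= 2]; the second uses [1 <= x] and [- 1 <= s - 1]. *)
    apply: (@le_trans _ _ ((x : R) `^ (- 1))).
      by rewrite powR_inv1 ?(ltW x0)// lef_pV2 ?posrE.
    by rewrite ler_powR// lerBrDr addNr ltW.
  rewrite ler_expR lerN2 ler_wpM2r ?invr_ge0 ?(ltW k0)//.
  by rewrite ge0_ler_powR ?nnegrE ?(ltW k0) ?(ltW x0).
Qed.

Lemma Gamma_k_gt0 (R : realType) (k s : R) : 0 < k -> 0 < s -> 0 < Gamma_k k s.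
Proof.
move=> k0 s0; apply: lt_le_trans (Gamma_k_ge k0 s0).
by rewrite mulr_gt0 ?invr_gt0 ?expR_gt0.
Qed.

(** * The k-beta integral and its relation to k-gamma *)

Definition beta_k_density (R : realType) (k a s v : R) : R :=
  v `^ (a - 1) * (1 + v `^ k) `^ (- ((s + a) / k)).

Definition ebeta_k (R : realType) (k a s : R) : \bar R :=
  (\int[lebesgue_measure]_(v in `]0%R, +oo[) (beta_k_density k a s v)%:E)%E.

Lemma beta_k_density_ge0 (R : realType) (k a s v : R) : 0 <= beta_k_density k a s v.
Proof. by rewrite mulr_ge0 ?powR_ge0. Qed.

Lemma measurable_beta_k_density (R : realType) (k a s : R) (D : set R) :
  measurable_fun D (beta_k_density k a s).
Proof.
apply: measurable_funTS; apply: measurable_funM => //.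
apply: (measurableT_comp (f := fun x : R => x `^ (- ((s + a) / k)))) => //.
exact: measurable_funD.
Qed.

(* Both sides equal
   [x `^ (s + a - 1) * v `^ (a - 1) * expR (- (x `^ k * (1 + v `^ k) / k))]. *)
Lemma gamma_k_density_mul (R : realType) (k a s x v : R) :
  0 < k -> 0 < x -> 0 < v ->
  gamma_k_density k s x * (x * gamma_k_density k a (x * v)) =
  beta_k_density k a s v * ((1 + v `^ k) `^ k^-1 *
    gamma_k_density k (s + a) ((1 + v `^ k) `^ k^-1 * x)).
Proof.
move=> k0 x0 v0; rewrite /gamma_k_density /beta_k_density.
have w0 : 0 < 1 + v `^ k by rewrite addr_gt0// powR_gt0.
set w := 1 + v `^ k in w0 *.
rewrite !(powRM _ (ltW x0) (ltW v0)) !(powRM _ (powR_ge0 _ _) (ltW x0)).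
rewrite -!powRrM (mulVf (lt0r_neq0 k0)).
rewrite (powRr1 (ltW w0)).
have -> : x * (x `^ (a - 1) * v `^ (a - 1) * expR (- (x `^ k * v `^ k / k))) =
    x `^ a * v `^ (a - 1) * expR (- (x `^ k * v `^ k / k)).
  rewrite -[X in X * (_ * _)](powRr1 (ltW x0)) !mulrA -powRD.
    by congr (_ `^ _ * _ * _); ring.
  by rewrite (gt_eqF x0) implybT.
have -> : x `^ (s + a - 1) = x `^ (s - 1) * x `^ a.
  by rewrite -powRD ?(gt_eqF x0) ?implybT//; congr (_ `^ _); ring.
(* The powers of [w] cancel: [- (s + a) / k + 1 / k + (s + a - 1) / k = 0]. *)
have wE : w `^ (- ((s + a) / k)) * (w `^ k^-1 * w `^ (k^-1 * (s + a - 1))) = 1.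
  rewrite -!powRD ?(gt_eqF w0) ?implybT//.
  rewrite (_ : _ + _ = 0) ?powRr0//; field; exact: lt0r_neq0.
have eE : expR (- (x `^ k / k)) * expR (- (x `^ k * v `^ k / k)) =
    expR (- (w * x `^ k / k)).
  by rewrite -expRD; congr expR; rewrite /w; field; exact: lt0r_neq0.
rewrite -eE; set E1 := expR _; set E2 := expR _.
transitivity (x `^ (s - 1) * x `^ a * v `^ (a - 1) * (E1 * E2)).
  by ring.
rewrite -[LHS]mulr1 -[X in _ * X = _]wE.
by ring.
Qed.

(** The k-analogue of Euler's gamma-beta identity. It is stated in the extended reals because
    finiteness of the beta integral is deduced from it. *)
Lemma egamma_k_mul (R : realType) (k a s : R) :
  0 < k -> 0 < a -> 0 < s ->
  (egamma_k k s * egamma_k k a = egamma_k k (s + a) * ebeta_k k a s)%E.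
Proof.
move=> k0 a0 s0.
have mg s' D : measurable_fun D (EFin \o gamma_k_density k s').
  by apply/measurable_EFinP; exact: measurable_gamma_k_density.
have g0 s' x : (0 <= (gamma_k_density k s' x)%:E)%E.
  by rewrite lee_fin gamma_k_density_ge0.
have sa0 : 0 < s + a by rewrite addr_gt0.
(* The integrand of the product after [y = x * v]; the inner factor [z.1] is the Jacobian. *)
pose h (z : R * R) : R :=
  gamma_k_density k s z.1 * (z.1 * gamma_k_density k a (z.1 * z.2)).
have mh : measurable_fun setT (EFin \o h).
  have m1 : measurable_fun setT (fst : R * R -> R) by exact: measurable_fst.
  have m2 : measurable_fun setT (snd : R * R -> R) by exact: measurable_snd.
  have m12 : measurable_fun setT (fun z : R * R => z.1 * z.2).
    exact: measurable_funM.
  apply/measurable_EFinP; apply: measurable_funM.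
    apply: measurableT_comp => //; exact: measurable_gamma_k_density.
  apply: measurable_funM => //.
  apply: measurableT_comp => //; exact: measurable_gamma_k_density.
transitivity (\int[lebesgue_measure]_(x in `]0%R, +oo[)
    \int[lebesgue_measure]_(v in `]0%R, +oo[) (h (x, v))%:E)%E.
  rewrite {1}/egamma_k -ge0_integralZr//; last 2 first.
  - exact: mg.
  - by apply: integral_ge0 => x _.
  apply: eq_integral => x; rewrite inE/= in_itv/= andbT => x0.
  rewrite /egamma_k (integral_scale_pos (c := x))//; last 2 first.
  - exact: measurable_gamma_k_density.
  - by move=> y _; exact: gamma_k_density_ge0.
  rewrite -ge0_integralZl_EFin//.
  - by move=> v _; rewrite lee_fin mulr_ge0 ?(ltW x0) ?gamma_k_density_ge0.
  - apply/measurable_EFinP; apply: measurable_funTS; apply: measurable_funM => //.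
    by apply: measurableT_comp => //; exact: measurable_gamma_k_density.
  - exact: gamma_k_density_ge0.
transitivity (\int[lebesgue_measure]_(v in `]0%R, +oo[)
    \int[lebesgue_measure]_(x in `]0%R, +oo[) (h (x, v))%:E)%E.
  apply: (@fubini_tonelli_setX _ _ (measurableTypeR R) (measurableTypeR R) R
    lebesgue_measure lebesgue_measure _ _ (EFin \o h)) => //.
  move=> [x v] [/=]; rewrite !in_itv/= !andbT => x0 v0; rewrite lee_fin /h/=.
  by apply: mulr_ge0; last apply: mulr_ge0; rewrite ?(ltW x0) ?gamma_k_density_ge0.
rewrite muleC /ebeta_k -ge0_integralZr//; last 3 first.
- by apply/measurable_EFinP; exact: measurable_beta_k_density.
- by move=> v _; rewrite lee_fin beta_k_density_ge0.
- by apply: integral_ge0 => x _.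
apply: eq_integral => v; rewrite inE/= in_itv/= andbT => v0.
(* Rescaling [x] by this factor turns [x]^ k * (1 + v [^ k)] into a pure [k]-th power, so the
   integral in [x] becomes [egamma_k k (s + a)]. *)
have w0 : 0 < (1 + v `^ k) `^ k^-1.
  by rewrite powR_gt0// addr_gt0// powR_gt0.
rewrite /egamma_k (integral_scale_pos w0)//; last 2 first.
- exact: measurable_gamma_k_density.
- by move=> y _; exact: gamma_k_density_ge0.
rewrite -[RHS]ge0_integralZl_EFin; last 4 first.
- exact: measurable_itv.
- by move=> x _; rewrite lee_fin mulr_ge0 ?(ltW w0) ?gamma_k_density_ge0.
- apply/measurable_EFinP; apply: measurable_funTS; apply: measurable_funM => //.
  by apply: measurableT_comp => //; exact: measurable_gamma_k_density.
- exact: beta_k_density_ge0.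
apply: eq_integral => x; rewrite inE/= in_itv/= andbT => x0.
by rewrite -EFinM /h/= gamma_k_density_mul.
Qed.

(** An infinite value, multiplied by the positive [Gamma_k k (s + a)], would make a product of two
    finite gamma values infinite. *)
Lemma ebeta_k_fin_num (R : realType) (k a s : R) : 0 < k -> 0 < a -> 0 < s ->
  ebeta_k k a s \is a fin_num.
Proof.
move=> k0 a0 s0; rewrite fin_numElt; apply/andP; split.
  apply: (@lt_le_trans _ _ 0%E) => //; apply: integral_ge0 => v _.
  by rewrite lee_fin beta_k_density_ge0.
rewrite ltey; apply/eqP => bE.
have := egamma_k_mul k0 a0 s0.
have sa0 := addr_gt0 s0 a0.
rewrite bE -(Gamma_kE k0 s0) -(Gamma_kE k0 a0) -(Gamma_kE k0 sa0).
by rewrite gt0_muley ?lte_fin ?(Gamma_k_gt0 k0 sa0).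
Qed.

Lemma Gamma_k_ratioE (R : realType) (k a s : R) : 0 < k -> 0 < a -> 0 < s ->
  Gamma_k k s / Gamma_k k (s + a) = fine (ebeta_k k a s) / Gamma_k k a.
Proof.
move=> k0 a0 s0; have := egamma_k_mul k0 a0 s0.
have sa0 := addr_gt0 s0 a0.
rewrite -(Gamma_kE k0 s0) -(Gamma_kE k0 a0) -(Gamma_kE k0 sa0).
rewrite -(fineK (ebeta_k_fin_num k0 a0 s0)) -!EFinM => -[E].
apply/eqP; rewrite eqr_div ?(lt0r_neq0 (Gamma_k_gt0 k0 _))//.
by rewrite E mulrC.
Qed.

(** * A linear form of log-convexity and its closure properties *)

Lemma convex_expR_num (R : realType) (t : {i01 R}) (a b : R) :
  expR (t%:num * a + (1 - t%:num) * b) <=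
  t%:num * expR a + (1 - t%:num) * expR b.
Proof. exact: (convex_expR t a b). Qed.

(* By weighted AM-GM, for positive [f] this is equivalent to
   [f (t x + (1 - t) y) <= f x `^ t * f y `^ (1 - t)]; being linear in [f], the
   condition passes to sums, series and integrals. *)
Definition tilted_convex_pos (R : realType) (f : R -> R) : Prop :=
  forall (t : {i01 R}) (x y p q : R), 0 < x -> 0 < y ->
    t%:num * p + (1 - t%:num) * q = 0 ->
    f (t%:num * x + (1 - t%:num) * y) <=
      t%:num * (expR p * f x) + (1 - t%:num) * (expR q * f y).

Lemma conv_gt0 (R : realType) (t : {i01 R}) (x y : R) :
  0 < x -> 0 < y -> 0 < t%:num * x + (1 - t%:num) * y.
Proof. exact: (@convR_gt0 R x y t). Qed.

Lemma onem_i01_ge0 (R : realType) (t : {i01 R}) : 0 <= 1 - t%:num.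
Proof. by rewrite subr_ge0. Qed.

Lemma tilted_convex_log_convex (R : realType) (f : R -> R) :
  (forall x, 0 < x -> 0 < f x) -> tilted_convex_pos f ->
  log_convex_on `]0%R, +oo[ f.
Proof.
move=> f0 cf; split => [x /=|t x y]; first by rewrite in_itv/= andbT; exact: f0.
rewrite !inE/= !in_itv/= !andbT => x0 y0.
change (ln (f (t%:num * x + (1 - t%:num) * y)) <=
  t%:num * ln (f x) + (1 - t%:num) * ln (f y)).
(* The tilts [m - ln (f x)] and [m - ln (f y)] have weighted mean 0 and make both terms on the right
   equal to [expR m]: this is the equality case of AM-GM. *)
set m := t%:num * ln (f x) + (1 - t%:num) * ln (f y).
have := cf t x y (m - ln (f x)) (m - ln (f y)) x0 y0.
rewrite !expRB !lnK ?posrE ?f0// !divfK ?lt0r_neq0 ?f0//.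
move=> h; rewrite -[leRHS]expRK ler_ln ?posrE ?expR_gt0 ?f0 ?conv_gt0//.
have -> : expR m = t%:num * expR m + (1 - t%:num) * expR m by ring.
by apply: h; rewrite /m; ring.
Qed.

Lemma tilted_convex_lim_series (R : realType) (w : R -> R^nat) :
  (forall n, tilted_convex_pos (w ^~ n)) ->
  (forall x, 0 < x -> cvgn (series (w x))) ->
  tilted_convex_pos (fun x => limn (series (w x))).
Proof.
move=> cw lw t x y p q x0 y0 pq.
have lx := @is_cvg_seriesZ _ _ (t%:num * expR p) (lw _ x0).
have ly := @is_cvg_seriesZ _ _ ((1 - t%:num) * expR q) (lw _ y0).
have := lim_seriesD lx ly.
rewrite (lim_seriesZ _ (lw _ x0)) (lim_seriesZ _ (lw _ y0)) => limE.
rewrite !mulrA; move: limE; rewrite /GRing.scale/= => <-.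
apply: lim_series_le => [||n]; first by apply: lw; exact: conv_gt0.
  exact: is_cvg_seriesD.
by have := cw n t x y p q x0 y0 pq; rewrite !mulrA.
Qed.

Lemma eq_tilted_convex (R : realType) (f g : R -> R) :
  (forall x, 0 < x -> f x = g x) -> tilted_convex_pos g -> tilted_convex_pos f.
Proof.
move=> fg cg t x y p q x0 y0 pq.
rewrite (fg _ x0) (fg _ y0) (fg _ (conv_gt0 t x0 y0)); exact: cg.
Qed.

Lemma tilted_convexZ (R : realType) (c : R) (f : R -> R) : 0 <= c ->
  tilted_convex_pos f -> tilted_convex_pos (fun x => c * f x).
Proof.
move=> c0 cf t x y p q x0 y0 pq.
apply: le_trans (ler_wpM2l c0 (cf t x y p q x0 y0 pq)) _.
by rewrite le_eqVlt; apply/predU1P; left; ring.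
Qed.

(** The condition concerns positive arguments only, and [0 <= c] keeps the shifted points
    positive. *)
Lemma tilted_convex_shift (R : realType) (c : R) (f : R -> R) : 0 <= c ->
  tilted_convex_pos f -> tilted_convex_pos (fun x => f (x + c)).
Proof.
move=> c0 cf t x y p q x0 y0 pq.
have := cf t (x + c) (y + c) p q (ltr_wpDr c0 x0) (ltr_wpDr c0 y0) pq.
by apply: le_trans; rewrite le_eqVlt; apply/predU1P; left; congr f; ring.
Qed.

(** This serves the term [n = 0], whose gamma ratio is constantly 1; convexity of [expR] bounds
    [1 = expR 0]. *)
Lemma tilted_convex1 (R : realType) : tilted_convex_pos (fun _ : R => 1 : R).
Proof.
move=> t x y p q _ _ pq; rewrite !mulr1.
by apply: le_trans (convex_expR_num t p q); rewrite pq expR0.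
Qed.

(** * Log-convexity of the k-gamma ratio *)

(** For fixed [v] the density is the exponential of an affine function of [s]. The tilts average to
    0, so the tilted exponents average to the exponent at the mean, and convexity of [expR]
    concludes. *)
Lemma tilted_convex_beta_k_density (R : realType) (k a v : R) : 0 < v ->
  tilted_convex_pos (fun s => beta_k_density k a s v).
Proof.
move=> v0 t x y p q x0 y0 pq.
have w0 : 0 < 1 + v `^ k by rewrite addr_gt0// powR_gt0.
have bE s : beta_k_density k a s v =
    expR ((a - 1) * ln v - (s + a) / k * ln (1 + v `^ k)).
  by rewrite /beta_k_density {1 2}/powR !gt_eqF// -expRD mulNr.
rewrite !bE -!expRD; apply: le_trans (convex_expR_num _ _ _).
rewrite ler_expR -[leLHS]addr0 -pq; rewrite le_eqVlt; apply/predU1P; left; ring.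
Qed.

(** The pointwise inequality is integrated over [v]; finiteness of the three beta integrals carries
    the result from the extended reals to their [fine] parts. *)
Lemma tilted_convex_beta_k (R : realType) (k a : R) : 0 < k -> 0 < a ->
  tilted_convex_pos (fun s => fine (ebeta_k k a s)).
Proof.
move=> k0 a0 t x y p q x0 y0 pq.
have mb s D : measurable_fun D (EFin \o beta_k_density k a s).
  by apply/measurable_EFinP; exact: measurable_beta_k_density.
have b0 s v : (0 <= (beta_k_density k a s v)%:E)%E.
  by rewrite lee_fin beta_k_density_ge0.
have t0 : 0 <= t%:num * expR p by rewrite mulr_ge0 ?expR_ge0.
have t1 : 0 <= (1 - t%:num) * expR q by rewrite mulr_ge0 ?expR_ge0 ?onem_i01_ge0.
rewrite -lee_fin !mulrA [X in (_ <= X)%E]EFinD (EFinM _ (fine (ebeta_k k a x))).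
rewrite (EFinM _ (fine (ebeta_k k a y))).
rewrite (fineK (ebeta_k_fin_num k0 a0 (conv_gt0 t x0 y0))).
rewrite (fineK (ebeta_k_fin_num k0 a0 x0)) (fineK (ebeta_k_fin_num k0 a0 y0)).
rewrite /ebeta_k -[X in (_ <= X + _)%E]ge0_integralZl_EFin; last 4 first.
- exact: measurable_itv.
- by move=> v _.
- exact: mb.
- exact: t0.
rewrite -[X in (_ <= _ + X)%E]ge0_integralZl_EFin; last 4 first.
- exact: measurable_itv.
- by move=> v _.
- exact: mb.
- exact: t1.
rewrite -[leRHS]ge0_integralD; last 5 first.
- exact: measurable_itv.
- by move=> v _; rewrite mule_ge0.
- exact: (measurable_funeM _ (mb _ _)).
- by move=> v _; rewrite mule_ge0.
- exact: (measurable_funeM _ (mb _ _)).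
apply: ge0_le_integral.
- exact: measurable_itv.
- by move=> v _.
- exact: mb.
- by apply: emeasurable_funD; exact: (measurable_funeM _ (mb _ _)).
- move=> v; rewrite /= in_itv/= andbT => v0.
  rewrite -!EFinM -EFinD lee_fin -!mulrA.
  exact: tilted_convex_beta_k_density.
Qed.

(** The case [a = 0], which occurs at [n = 0], is treated apart: the beta integral diverges there,
    while the ratio is 1. *)
Lemma tilted_convex_Gamma_k_ratio (R : realType) (k a : R) : 0 < k -> 0 <= a ->
  tilted_convex_pos (fun s => Gamma_k k s / Gamma_k k (s + a)).
Proof.
move=> k0; rewrite le_eqVlt => /predU1P[<-|a0].
  apply: (eq_tilted_convex _ (@tilted_convex1 R)) => s s0.
  by rewrite addr0 divff// lt0r_neq0// Gamma_k_gt0.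
have cB := tilted_convex_beta_k k0 a0.
have G0 : 0 <= (Gamma_k k a)^-1 by rewrite invr_ge0 ltW// Gamma_k_gt0.
apply: (eq_tilted_convex _ (tilted_convexZ G0 cB)) => s s0.
by rewrite (Gamma_k_ratioE k0 a0 s0) mulrC.
Qed.

(** * Convergence of the k-Bessel series *)

Lemma pochhammer_k_ge0 (R : realType) (k c : R) (n : nat) :
  0 <= k -> 0 <= c -> 0 <= pochhammer_k k c n.
Proof. by move=> k0 c0; apply: prodr_ge0 => i _; rewrite addr_ge0 ?mulr_ge0. Qed.

(** Each factor satisfies [c + i * k <= (c + k) * (i + 1)]. The resulting [n!] will cancel one of
    the two in the denominator of the series, leaving an exponential series. *)
Lemma pochhammer_k_le (R : realType) (k c : R) (n : nat) :
  0 <= k -> 0 <= c -> pochhammer_k k c n <= (c + k) ^+ n * n`!%:R.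
Proof.
move=> k0 c0; elim: n => [|n IH]; first by rewrite /pochhammer_k big_ord0 fact0 mulr1.
rewrite /pochhammer_k big_ord_recr/= -/(pochhammer_k k c n) exprSr factS natrM.
have -> : (c + k) ^+ n * (c + k) * (n.+1%:R * n`!%:R) =
  ((c + k) ^+ n * n`!%:R) * ((c + k) * n.+1%:R) by ring.
have n0 : 0 <= n%:R :> R by [].
have cn : 0 <= c * n%:R by rewrite mulr_ge0.
apply: ler_pM => //; first exact: pochhammer_k_ge0.
  by rewrite addr_ge0 ?mulr_ge0.
by rewrite -natr1; nra.
Qed.

Lemma is_cvg_series_bessel_k (R : realType) (k gamma lambda nu x : R) :
  0 < k -> 0 < gamma -> 0 < lambda -> 0 < x -> 0 < nu ->
  cvgn (series (fun n : nat =>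
    pochhammer_k k gamma n / Gamma_k k (lambda * n%:R + nu + 1)
    * ((x / 2) ^+ n / (n`!)%:R ^+ 2))).
Proof.
move=> k0 gamma0 lambda0 x0 nu0.
(* The lower bound of [Gamma_k_ge] does not depend on the argument, hence is uniform in [n]. *)
set C := 2^-1 * expR (- (2 `^ k / k)).
have C0 : 0 < C by rewrite mulr_gt0 ?invr_gt0 ?expR_gt0.
have s0 n : 0 < lambda * n%:R + nu + 1.
  by rewrite -addrA ltr_wpDl ?addr_gt0// mulr_ge0// ltW.
have z0 : 0 <= x / 2 by rewrite divr_ge0 ?ltW.
apply: (@series_le_cvg _ _ (C^-1 *: exp_coeff ((gamma + k) * (x / 2)))).
- move=> n; rewrite mulr_ge0 ?divr_ge0 ?exprn_ge0//.
    by rewrite pochhammer_k_ge0 ?ltW.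
  by rewrite ltW// Gamma_k_gt0.
- move=> n; rewrite mulr_ge0 ?invr_ge0 ?(ltW C0)// exp_coeff_ge0//.
  by rewrite mulr_ge0 ?addr_ge0 ?(ltW k0) ?(ltW gamma0).
- move=> n.
  have f0 : 0 < n`!%:R :> R by rewrite ltr0n fact_gt0.
  apply: (@le_trans _ _ (((gamma + k) ^+ n * n`!%:R) * C^-1 *
      ((x / 2) ^+ n / (n`!)%:R ^+ 2))).
    rewrite ler_wpM2r ?divr_ge0 ?exprn_ge0//.
    apply: ler_pM.
    + by rewrite pochhammer_k_ge0 ?ltW.
    + by rewrite invr_ge0 ltW// Gamma_k_gt0.
    + by rewrite pochhammer_k_le ?ltW.
    + by rewrite lef_pV2 ?posrE ?Gamma_k_gt0// Gamma_k_ge.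
  rewrite le_eqVlt; apply/predU1P; left; rewrite -[RHS]/(C^-1 * (((gamma + k) * (x / 2)) ^+ n / n`!%:R)).
  rewrite [((gamma + k) * _) ^+ n]exprMn.
  move: (_ ^+ n) (_ ^+ n) (n`!%:R) f0 => A B f f0.
  by field; rewrite !gt_eqF.
- by apply: is_cvg_seriesZ; exact: is_cvg_series_exp_coeff.
Qed.

(** * Log-convexity of the normalized k-Bessel function in its order *)

Theorem theorem3p1 (R : realType) (k gamma lambda x : R)
    (k_gt0 : 0 < k) (gamma_gt0 : 0 < gamma) (lambda_gt0 : 0 < lambda)
    (x_gt0 : 0 < x) :
  log_convex_on `]0%R, +oo[
    (fun nu : R => normalized_bessel_k k gamma lambda nu x).
Proof.
have z0 : 0 <= x / 2 by rewrite divr_ge0 ?ltW.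
pose u nu n := pochhammer_k k gamma n / Gamma_k k (lambda * n%:R + nu + 1)
  * ((x / 2) ^+ n / (n`!)%:R ^+ 2).
have cu nu : 0 < nu -> cvgn (series (u nu)).
  exact: is_cvg_series_bessel_k.
apply: tilted_convex_log_convex => [nu nu0|].
  have G0 : 0 < Gamma_k k (nu + 1) by rewrite Gamma_k_gt0 ?addr_gt0.
  rewrite /normalized_bessel_k mulr_gt0//.
  have u0 n : 0 <= u nu n.
    rewrite /u mulr_ge0 ?divr_ge0 ?exprn_ge0 ?pochhammer_k_ge0 ?(ltW k_gt0)//.
      exact: ltW.
    rewrite ltW// Gamma_k_gt0// ltr_wpDr// ltr_wpDl//.
    by rewrite mulr_ge0// ltW.
  have nd : {homo series (u nu) : n m / (n <= m)%N >-> n <= m}.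
    by apply: nondecreasing_series => n _ _.
  (* The partial sum of index 1 consists of the term [n = 0] alone, which is the inverse of
     [Gamma_k k (nu + 1)] and hence positive. *)
  apply: lt_le_trans (nondecreasing_cvgn_le nd (cu _ nu0) 1%N).
  rewrite /series/= big_nat1 /u /pochhammer_k big_ord0 expr0 fact0.
  by rewrite expr1n divr1 mulr1 mulr0 add0r div1r invr_gt0.
(* The normalizing factor is moved inside the series, so that [nu] enters each term only through a
   gamma ratio with [s = nu + 1] and [a = lambda * n]. *)
pose w nu n := pochhammer_k k gamma n * ((x / 2) ^+ n / (n`!)%:R ^+ 2) *
  (Gamma_k k (nu + 1) / Gamma_k k (nu + 1 + lambda * n%:R)).
have wE nu : w nu = Gamma_k k (nu + 1) *: u nu.
  apply/funext => n; rewrite /w -[RHS]/(Gamma_k k (nu + 1) * u nu n) /u.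
  rewrite (_ : nu + 1 + lambda * n%:R = lambda * n%:R + nu + 1); last by ring.
  by ring.
have lw nu : 0 < nu -> cvgn (series (w nu)).
  by move=> nu0; rewrite wE; apply: is_cvg_seriesZ; exact: cu.
have bE nu : 0 < nu ->
    normalized_bessel_k k gamma lambda nu x = limn (series (w nu)).
  by move=> nu0; rewrite wE lim_seriesZ//; exact: cu.
have cw n : tilted_convex_pos (w ^~ n).
  apply: tilted_convexZ.
    by rewrite mulr_ge0 ?pochhammer_k_ge0 ?(ltW k_gt0) ?(ltW gamma_gt0)// divr_ge0// exprn_ge0.
  (* The shift by 1 passes from [s] to [nu + 1]. *)
  apply: (@tilted_convex_shift _ 1
    (fun s => Gamma_k k s / Gamma_k k (s + lambda * n%:R))) => //.
  by apply: tilted_convex_Gamma_k_ratio => //; rewrite mulr_ge0 ?(ltW lambda_gt0).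
exact: (eq_tilted_convex bE (tilted_convex_lim_series cw lw)).
Qed.
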